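(* Let $S$ be a symmetric operator in a Hilbert space $H$ with finite and equal defect indices, $V\ge0$ a bounded operator on $H$, $A=S+\mathrm{i}V$, and let $\widehat A$ be a maximally dissipative extension of $A$. Let $\widehat S=S^*|_{\mathcal{D}(\widehat A)}$, let $\widetilde S=S^*|_{\mathcal{H}_{\mathrm{sym}}(\widehat S)}$ be its symmetric part, with defect indices $(\ell,\ell)$, let $(\widetilde\Gamma_0,\widetilde\Gamma_1,\mathbb{C}^\ell)$ be a boundary triple for $\widetilde S^*$, let $\widetilde B,\widetilde C$ be invertible $\ell\times\ell$ matrices with $\mathcal{D}(\widehat S)=\{f\in\mathcal{D}(\widetilde S^* ):\widetilde B\widetilde\Gamma_0f=\widetilde C\widetilde\Gamma_1f\}$, let $k_1,\dots,k_\ell\in\operatorname{rg}(V^{1/2})$ be the vectors with $$\widehat Af=(S^*+\mathrm{i}V)f+\sum_{j=1}^\ell(\widetilde\Gamma_1f)_jk_j,\qquad f\in\mathcal{D}(\widehat A),$$ and let $M_{\mathtt K}=(\langle V^{-1/2}k_r,V^{-1/2}k_s\rangle)_{r,s=1}^\ell$. Then there exists a subspace $W\subseteq\mathcal{H}_{\mathrm{sym}}(\widehat A)$ with $W\cap\mathcal{D}(\widetilde S)=W\cap\ker V=\{0\}$ and $$\dim W\le\nu:=\ell-\operatorname{rk}\Big(\operatorname{Im}(\widetilde C^*\widetilde B^{*-1})-\tfrac14M_{\mathtt K}\Big)$$ such that $$\mathcal{H}_{\mathrm{sym}}(\widehat A)=\big(\mathcal{D}(\widetilde S)\cap\ker V\big)\dot+W.$$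 In particular, $W=\{0\}$ if $\operatorname{Im}(\widetilde C^*\widetilde B^{*-1})>\frac14M_{\mathtt K}$.
   Context: Hilbert spaces are complex; inner products are linear in the second argument; symmetric operators are densely defined; $S$ is closed. A densely defined operator $T$ is dissipative if $\operatorname{Im}\langle x,Tx\rangle\ge0$ for all $x\in\mathcal{D}(T)$, and maximally dissipative if it has moreover no non-trivial dissipative extension. For a densely defined $T$, $\mathcal{H}_{\mathrm{sym}}(T):=\ker(T-T^* )=\{f\in\mathcal{D}(T)\cap\mathcal{D}(T^* ):Tf=T^*f\}$. For a square matrix $M$, $\operatorname{Im}M=\frac1{2\mathrm{i}}(M-M^* )$; $M>N$ means $M-N$ is positive definite. $V^{-1/2}:\operatorname{rg}(V^{1/2})\to(\ker V)^\perp$ is the inverse of $V^{1/2}$ restricted to $(\ker V)^\perp$. Boundary triple: $(\Gamma_0,\Gamma_1,\mathbb{C}^\ell)$ is a boundary triple for $T^*$, $T$ symmetric with defect indices $(\ell,\ell)$, if $\Gamma_0,\Gamma_1:\mathcal{D}(T^* )\to\mathbb{C}^\ell$ are linear, $(\Gamma_0,\Gamma_1)$ is surjective onto $\mathbb{C}^\ell\oplus\mathbb{C}^\ell$, $\langle f,T^*g\rangle-\langle T^*f,g\rangle=\langle\Gamma_0f,\Gamma_1g\rangle-\langle\Gamma_1f,\Gamma_0g\rangle$ for $f,g\in\mathcal{D}(T^* )$, and $\mathcal{D}(T)=\ker\Gamma_0\cap\ker\Gamma_1$. Standing facts: $\mathcal{D}(\widehat A)\subseteq\mathcal{D}(S^*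 )$; $\widehat S$ is a maximally dissipative extension of $S$; $\widetilde S$ ($\mathcal{D}(\widetilde S)=\mathcal{H}_{\mathrm{sym}}(\widehat S)$, $\widetilde Sf=S^*f$) is closed symmetric with equal finite defect indices $\ell$, and $S\subseteq\widetilde S\subseteq\widehat S\subseteq\widetilde S^*\subseteq S^*$. Matrices $\widetilde B,\widetilde C$ describing $\widehat S$ exist and are automatically invertible. $\widehat A$ is a maximally dissipative extension of $\widetilde S+\mathrm{i}V$; writing $\mathcal{D}(\widehat A)=\mathcal{D}(\widetilde S)\dot+\mathcal{U}$ with $\mathcal{U}=\operatorname{span}\{u_1,\dots,u_\ell\}$, $\widetilde\Gamma_1u_j=\vec e_j$, one has $\widehat Af=(S^*+\mathrm{i}V)f+\mathcal{L}Pf$ with $P$ the projection onto $\mathcal{U}$ along $\mathcal{D}(\widetilde S)$ and a linear map $\mathcal{L}:\mathcal{U}\to\operatorname{rg}(V^{1/2})$, and $k_j=\mathcal{L}u_j$. *)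

(* Defs.v *)
From HB Require Import structures.
From mathcomp Require Import all_boot all_order all_algebra.
From mathcomp Require Import complex.
From mathcomp Require Import all_classical all_reals all_analysis.

Set Implicit Arguments.
Unset Strict Implicit.
Unset Printing Implicit Defensive.

Import Order.TTheory GRing.Theory Num.Theory Num.Def.
Import numFieldNormedType.Exports.

Local Open Scope classical_set_scope.
Local Open Scope ring_scope.
Local Open Scope sesquilinear_scope.

(* Library forms [{dot H for conjC}] are linear in their FIRST argument; [inner]
   below swaps the arguments. *)
HB.mixin Record CompleteNormedModule_isHilbert (R : realType) H
    of CompleteNormedModule R[i] H := {
  dotform : {dot H for (@conjC R[i])} ;
  dotform_norm : forall x : H, dotform x x = `|x| ^+ 2 }.

#[short(type="hilbertType")]
HB.structure Definition Hilbert (R : realType) :=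
  { H of CompleteNormedModule R[i] H & CompleteNormedModule_isHilbert R H }.

Definition inner (R : realType) (H : hilbertType R) (x y : H) : R[i] :=
  dotform y x.

Notation "''[' x , y ]" := (inner x y)
  (format "''[' x ,  y ]") : ring_scope.

Section linear_algebra.
Context (K : fieldType) (E F : lmodType K).

Definition linear_subspace (D : set E) : Prop :=
  D 0 /\ forall (a : K) x y, D x -> D y -> D (a *: x + y).

Definition linear_on (D : set E) (f : E -> F) : Prop :=
  forall (a : K) x y, D x -> D y -> f (a *: x + y) = a *: f x + f y.

(* [D] is a subspace of finite dimension [n]. *)
Definition has_dim (n : nat) (D : set E) : Prop :=
  exists b : 'I_n -> E,
    (forall c : 'I_n -> K, \sum_i c i *: b i = 0 -> forall i, c i = 0) /\
    D = [set x | exists c : 'I_n -> K, x = \sum_i c i *: b i].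

Definition direct_sum (D D1 D2 : set E) : Prop :=
  D = [set x | exists u v, [/\ D1 u, D2 v & x = u + v]] /\
  D1 `&` D2 = [set 0].

End linear_algebra.

Section matrices.
Context (R : realType) (n : nat).

Definition innerC (u v : 'cV[R[i]]_n) : R[i] := \sum_i (u i 0)^* * v i 0.

Definition mxIm (M : 'M[R[i]]_n) : 'M[R[i]]_n := (2 * 'i)^-1 *: (M - M^t*).

(* The order of [R[i]] makes [0 < z] imply that [z] is real, so such an [M] is
   automatically Hermitian. *)
Definition posdef (M : 'M[R[i]]_n) : Prop :=
  forall c : 'cV[R[i]]_n, c != 0 -> 0 < innerC c (M *m c).

End matrices.

Section operators.
Context (R : realType) (H : hilbertType R).

(* A possibly unbounded operator in [H]. The values of [app] outside [dom] are
   irrelevant, so operators must be compared with [extends], not with [=]. *)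
Record operator := Operator { dom : set H ; app :> H -> H }.

Implicit Types T : operator.

Definition linear_operator T : Prop :=
  linear_subspace (dom T) /\ linear_on (dom T) T.

Definition densely_defined T : Prop := linear_operator T /\ dense (dom T).

Definition extends T T' : Prop :=
  dom T `<=` dom T' /\ forall f, dom T f -> T' f = T f.

Definition restrict_op T (D : set H) : operator := Operator (D `&` dom T) T.

Definition closed_operator T : Prop :=
  closed [set p : H * H | dom T p.1 /\ p.2 = T p.1].

Definition adjoint_graph T (f : H) : set H :=
  [set h | forall g, dom T g -> '[f, T g] = '[h, g]].

(* For densely defined [T], [adjoint_graph T f] has at most one element. *)
Definition adjoint T : operator :=
  Operator [set f | exists h, adjoint_graph T f h]
           (fun f => xget 0 (adjoint_graph T f)).

Definition symmetric_operator T : Prop :=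
  densely_defined T /\
  forall f g, dom T f -> dom T g -> '[f, T g] = '[T f, g].

Definition dissipative T : Prop :=
  densely_defined T /\ forall x, dom T x -> 0 <= 'Im '[x, T x].

Definition maximally_dissipative T : Prop :=
  dissipative T /\
  forall T', dissipative T' -> extends T T' -> extends T' T.

Definition Hsym T : set H :=
  [set f | [/\ dom T f, dom (adjoint T) f & T f = adjoint T f]].

Definition has_defect_indices T (p q : nat) : Prop :=
  has_dim p [set f | dom (adjoint T) f /\ adjoint T f = 'i *: f] /\
  has_dim q [set f | dom (adjoint T) f /\ adjoint T f = - 'i *: f].

Definition boundary_triple (l : nat) T (Gamma0 Gamma1 : H -> 'cV[R[i]]_l) :
    Prop :=
  let D := dom (adjoint T) in
  [/\ linear_on D Gamma0 /\ linear_on D Gamma1,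
      forall a b, exists f, [/\ D f, Gamma0 f = a & Gamma1 f = b],
      forall f g, D f -> D g ->
        '[f, adjoint T g] - '[adjoint T f, g] =
        innerC (Gamma0 f) (Gamma1 g) - innerC (Gamma1 f) (Gamma0 g)
    & dom T = [set f | [/\ D f, Gamma0 f = 0 & Gamma1 f = 0]]].

Implicit Types V Vhalf : {linear H -> H}.

Definition bounded_operator V : Prop :=
  exists M : R[i], forall x, `|V x| <= M * `|x|.

(* [0 <= z] in [R[i]] includes that [z] is real. *)
Definition nonneg_operator V : Prop := forall x, 0 <= '[x, V x].

Definition is_sqrt V Vhalf : Prop :=
  [/\ bounded_operator Vhalf, nonneg_operator Vhalf
    & forall x, Vhalf (Vhalf x) = V x].

Definition kerV V : set H := [set x | V x = 0].

Definition orthogonal_complement (D : set H) : set H :=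
  [set x | forall y, D y -> '[y, x] = 0].

(* [V^{-1/2} k], for [Vhalf = V^{1/2}] and [k] in the range of [Vhalf]. *)
Definition inv_sqrt V Vhalf (k : H) : H :=
  xget 0 [set x | orthogonal_complement (kerV V) x /\ Vhalf x = k].

Definition add_iV T V : operator :=
  Operator (dom T) (fun x => T x + 'i *: V x).

Definition MK (l : nat) V Vhalf (k : 'I_l -> H) : 'M[R[i]]_l :=
  \matrix_(r, s) '[inv_sqrt V Vhalf (k r), inv_sqrt V Vhalf (k s)].

End operators.

(* Main.v *)
(* For [f, g] in [dom Ahat], completing the square in the boundary triple
   identity gives
     <f, Ahat g> - <Ahat f, g> = 2i (<w f, w g> + <G1 f, N (G1 g)>),
   where [w f = V^(1/2) f - (i/2) sum_j (G1 f)_j V^(-1/2) k_j].  Hence [f] lies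
   in [Hsym Ahat] iff [w f = 0] and [(G1 f)^* N = 0]: test the form first on the
   dense set [dom Stilde], where [G1] vanishes, then use that [G1] is onto.  The
   kernel of [G1] on [Hsym Ahat] is [dom Stilde] intersected with [ker V], and
   any complement [W] of it embeds via [G1] into a space of dimension
   [l - rk N]. *)

Require Import Defs.
From HB Require Import structures.
From mathcomp Require Import all_boot all_order all_algebra.
From mathcomp Require Import complex.
From mathcomp Require Import all_classical all_reals all_analysis.
From mathcomp Require Import ring lra.

Set Implicit Arguments.
Unset Strict Implicit.
Unset Printing Implicit Defensive.

Import Order.TTheory GRing.Theory Num.Theory Num.Def.
Import numFieldNormedType.Exports.
Local Open Scope classical_set_scope.
Local Open Scope ring_scope.
Local Open Scope sesquilinear_scope.

(** * Linear maps given on a subspace *)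

Section linear_maps.
Context (K : fieldType) (E F : lmodType K) (D : set E) (G : E -> F).
Hypotheses (sD : linear_subspace D) (lG : linear_on D G).

Lemma linear_subspaceD x y : D x -> D y -> D (x + y).
Proof. by have [_ DP] := sD; move=> Dx Dy; rewrite -[x]scale1r; exact: DP. Qed.

Lemma linear_subspaceZ a x : D x -> D (a *: x).
Proof. by have [D0 DP] := sD; move=> Dx; rewrite -[_ *: _]addr0; exact: DP. Qed.

Lemma linear_subspaceB x y : D x -> D y -> D (x - y).
Proof.
by have [_ DP] := sD; move=> Dx Dy; rewrite addrC -scaleN1r; exact: DP.
Qed.

Lemma linear_subspace_sum m (c : 'I_m -> K) (b : 'I_m -> E) :
  (forall i, D (b i)) -> D (\sum_i c i *: b i).
Proof.
move=> Db; elim/big_ind: _ => [|x y|i _]; first by case: sD.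
  exact: linear_subspaceD.
exact: linear_subspaceZ.
Qed.

Lemma linear_on0 : G 0 = 0.
Proof.
have [D0 _] := sD; apply: (addrI (G 0)).
by rewrite -[X in X + _ = _]scale1r -lG // scale1r !addr0.
Qed.

Lemma linear_onD x y : D x -> D y -> G (x + y) = G x + G y.
Proof. by move=> Dx Dy; rewrite -[x]scale1r lG // !scale1r. Qed.

Lemma linear_onZ a x : D x -> G (a *: x) = a *: G x.
Proof. by move=> Dx; rewrite -[_ *: x]addr0 lG ?linear_on0 ?addr0 //; case: sD. Qed.

Lemma linear_onB x y : D x -> D y -> G (x - y) = G x - G y.
Proof. by move=> Dx Dy; rewrite -scaleN1r addrC lG // scaleN1r addrC. Qed.

Lemma linear_on_sum m (c : 'I_m -> K) (b : 'I_m -> E) :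
  (forall i, D (b i)) -> G (\sum_i c i *: b i) = \sum_i c i *: G (b i).
Proof.
elim: m c b => [|m IH] c b Db; first by rewrite !big_ord0 linear_on0.
rewrite !big_ord_recl linear_onD.
- by rewrite linear_onZ // IH.
- exact: linear_subspaceZ.
- exact: linear_subspace_sum.
Qed.

End linear_maps.

(** * Finite-dimensional complements of the kernel of a linear map *)

Section kernel_complement.
Context (K : fieldType) (E : lmodType K) (l : nat).
Context (D : set E) (G : E -> 'cV[K]_l).
Hypotheses (sD : linear_subspace D) (lG : linear_on D G).

(** The images are stored as rows because ranks and spans are those of row spaces: independence of
    the images is then [row_free (rows b)]. *)
Let rows m (b : 'I_m -> E) : 'M[K]_(m, l) := \matrix_i (G (b i))^T.

Let rowsE m (c : 'I_m -> K) (b : 'I_m -> E) : (forall i, D (b i)) ->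
  (\row_i c i) *m rows b = (G (\sum_i c i *: b i))^T.
Proof.
move=> Db; rewrite mulmx_sum_row (linear_on_sum sD lG) // linear_sum.
by apply: eq_bigr => i _; rewrite mxE rowK linearZ.
Qed.

(* The family [b] is chosen maximal among those in [D] with linearly
   independent images under [G]. *)
Lemma exists_kernel_complement p (M : 'M[K]_(p, l)) :
  (forall x, D x -> M *m G x = 0) ->
  exists m (b : 'I_m -> E), [/\ (m <= l - \rank M)%N, forall i, D (b i),
    forall c : 'I_m -> K, G (\sum_i c i *: b i) = 0 -> forall i, c i = 0 &
    forall x, D x -> exists c : 'I_m -> K, G (x - \sum_i c i *: b i) = 0].
Proof.
move=> MG.
pose P m := `[< exists b : 'I_m -> E, (forall i, D (b i)) /\ row_free (rows b) >].
have bound m : P m -> (m <= l - \rank M)%N.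
  move=> /asboolP[b [Db fb]].
  (* The rows lie in the left kernel of [M^T], so the two ranks add up to at most [l]. *)
  have /mulmx0_rank_max : rows b *m M^T = 0.
    apply/row_matrixP => i; rewrite row_mul rowK -trmx_mul MG // trmx0.
    by rewrite row0.
  by rewrite (eqP fb) mxrank_tr => ?; rewrite leq_subRL ?rank_leq_col // addnC.
have P0 : exists m, P m.
  exists 0%N; apply/asboolP; exists (fun=> 0).
  by split; [case|rewrite /row_free -leqn0 rank_leq_row].
case: (ex_maxnP P0 bound) => m Pm maxm.
exists m; move/asboolP: (Pm) => [b [Db fb]]; exists b; split=> //.
- exact: bound.
- move=> c Gc0 i.
  have : (\row_i c i) *m rows b = 0 *m rows b by rewrite rowsE // Gc0 trmx0 mul0mx.
  by move=> /(row_free_inj fb) /rowP /(_ i); rewrite !mxE.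
- move=> x Dx.
  have [/submxP[c xc]|xb] := boolP ((G x)^T <= rows b)%MS.
    exists (fun i => c 0 i); apply: trmx_inj.
    rewrite (linear_onB lG) //; last exact: linear_subspace_sum.
    rewrite linearB /= -rowsE // xc.
    have -> : \row_i c 0 i = c by apply/rowP => i; rewrite mxE.
    by rewrite subrr trmx0.
  (* If [G x] is outside the span of the rows, putting [x] in front of [b] gives a longer
     independent family, against the maximality of [m]. *)
  pose b' (i : 'I_m.+1) := oapp b x (unlift ord0 i).
  suff /maxm : P m.+1 by rewrite ltnn.
  have Db' i : D (b' i) by rewrite /b'; case: unliftP => [j|] _ //=.
  apply/asboolP; exists b'; split=> //; apply: inj_row_free => v.
  have -> : v = \row_i v 0 i by apply/rowP => i; rewrite mxE.
  have b'l i : b' (lift ord0 i) = b i by rewrite /b' liftK.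
  have b'0 : b' ord0 = x by rewrite /b' unlift_none.
  rewrite rowsE // (linear_on_sum sD lG) // big_ord_recl b'0.
  under eq_bigr do rewrite b'l.
  rewrite -(linear_on_sum sD lG) // linearD /= -rowsE // linearZ /=.
  (* If [x] has coefficient zero, freeness of [b] kills the others; if not, dividing by it puts
     [G x] in the span, against [xb]. *)
  have [v0|v0] := eqVneq (v 0 ord0) 0.
    rewrite v0 scale0r add0r -[X in _ = X](mul0mx _ (rows b)).
    move=> /(row_free_inj fb) /rowP w0; apply/rowP => i; rewrite !mxE.
    have [j ->|->] := unliftP ord0 i; last exact: v0.
    by have := w0 j; rewrite !mxE.
  move=> /eqP; rewrite addr_eq0 => /eqP vx; case/negP: xb.
  rewrite -(eqmx_scale _ v0) vx eqmx_opp; exact: submxMl.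
Qed.
End kernel_complement.

(** * Real and imaginary parts *)

Section complex_parts.
Context (R : realType).
Implicit Types (x y : R[i]) (a : R).

(** The parts used here take values in [R], unlike ['Re] and ['Im], so that estimates become goals
    for [lra]. *)
Lemma RecD x y : complex.Re (x + y) = complex.Re x + complex.Re y.
Proof. by case: x y => [? ?] [? ?]. Qed.

Lemma RecN x : complex.Re (- x) = - complex.Re x.
Proof. by case: x. Qed.

Lemma RecM x y : complex.Re (x * y) =
  complex.Re x * complex.Re y - complex.Im x * complex.Im y.
Proof. by case: x y => [? ?] [? ?]. Qed.

Lemma ImcM x y : complex.Im (x * y) =
  complex.Re x * complex.Im y + complex.Im x * complex.Re y.
Proof. by case: x y => [? ?] [? ?]. Qed.

Lemma ImcD x y : complex.Im (x + y) = complex.Im x + complex.Im y.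
Proof. by case: x y => [? ?] [? ?]. Qed.

Lemma ImcN x : complex.Im (- x) = - complex.Im x.
Proof. by case: x. Qed.

Lemma conjCE x : x^* = Complex (complex.Re x) (- complex.Im x).
Proof. by case: x. Qed.

Lemma Rec_conj x : complex.Re x^* = complex.Re x.
Proof. by rewrite conjCE. Qed.

Lemma Imc_conj x : complex.Im x^* = - complex.Im x.
Proof. by rewrite conjCE. Qed.

End complex_parts.

(** * Inner products, density and representation of functionals *)

Section inner_product.
Context (R : realType) (H : hilbertType R).
Implicit Types (x y z : H) (a : R[i]).

Lemma innerDr x y z : '[x, y + z] = '[x, y] + '[x, z].
Proof. exact: linearDl. Qed.

Lemma innerZr a x y : '[x, a *: y] = a * '[x, y].
Proof. exact: linearZl_LR. Qed.

Lemma inner_conj x y : '[x, y]^* = '[y, x].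
Proof. by rewrite /inner [RHS]hermC expr0 mul1r. Qed.

Lemma innerDl x y z : '[x + y, z] = '[x, z] + '[y, z].
Proof. by rewrite -inner_conj innerDr rmorphD /= !inner_conj. Qed.

Lemma innerZl a x y : '[a *: x, y] = a^* * '[x, y].
Proof. by rewrite -inner_conj innerZr rmorphM /= inner_conj. Qed.

Lemma innerNr x y : '[x, - y] = - '[x, y].
Proof. by rewrite -scaleN1r innerZr mulN1r. Qed.

Lemma innerNl x y : '[- x, y] = - '[x, y].
Proof. by rewrite -scaleN1r innerZl rmorphN1 mulN1r. Qed.

Lemma inner0r x : '[x, 0] = 0.
Proof. by rewrite -(scale0r 0) innerZr mul0r. Qed.

Lemma inner0l x : '[0, x] = 0.
Proof. by rewrite -inner_conj inner0r rmorph0. Qed.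

Lemma inner_suml (I : finType) (c : I -> R[i]) (v : I -> H) x :
  '[\sum_i c i *: v i, x] = \sum_i (c i)^* * '[v i, x].
Proof.
rewrite (big_morph (fun y => '[y, x]) (fun y z => innerDl y z x) (inner0l x)).
by apply: eq_bigr => i _; rewrite innerZl.
Qed.

Lemma inner_sumr (I : finType) (c : I -> R[i]) (v : I -> H) x :
  '[x, \sum_i c i *: v i] = \sum_i c i * '[x, v i].
Proof.
rewrite (big_morph (fun y => '[x, y]) (innerDr x) (inner0r x)).
by apply: eq_bigr => i _; rewrite innerZr.
Qed.

(** The norm of [H] takes values in [R[i]]; this is its square as an element of [R]. *)
Definition normsq x : R := complex.Re '[x, x].

Lemma inner_normsq x : '[x, x] = (normsq x)%:C%C.
Proof.
rewrite /normsq RRe_real // /inner dotform_norm.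
by apply: ger0_real; rewrite exprn_ge0.
Qed.

Lemma normsq_norm x : `|x| ^+ 2 = (normsq x)%:C%C.
Proof. by rewrite -inner_normsq /inner dotform_norm. Qed.

Lemma normsq_ge0 x : 0 <= normsq x.
Proof. by rewrite -ler0c -normsq_norm exprn_ge0. Qed.

Lemma normsq_eq0 x : normsq x = 0 -> x = 0.
Proof.
move=> x0; apply/eqP; rewrite -normr_eq0 -sqrf_eq0.
by rewrite normsq_norm x0.
Qed.

Lemma norm_lt x (e : R) : 0 < e -> (`|x| < e%:C%C) = (normsq x < e ^+ 2).
Proof.
move=> e0; rewrite -ltcR -normsq_norm rmorphXn /= ltr_pXn2r //.
  by rewrite nnegrE.
by rewrite nnegrE ler0c ltW.
Qed.

Lemma Re_innerC x y : complex.Re '[x, y] = complex.Re '[y, x].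
Proof. by rewrite -inner_conj Rec_conj. Qed.

Lemma normsqD x y : normsq (x + y) = normsq x + normsq y + 2 * complex.Re '[x, y].
Proof.
rewrite /normsq innerDl !innerDr !RecD (Re_innerC y x); ring.
Qed.

Lemma normsqZ a x :
  normsq (a *: x) = (complex.Re a ^+ 2 + complex.Im a ^+ 2) * normsq x.
Proof.
rewrite /normsq innerZl innerZr inner_normsq mulrA RecM RecM ImcM Rec_conj Imc_conj /=.
ring.
Qed.

Lemma normsqN x : normsq (- x) = normsq x.
Proof. by rewrite /normsq innerNl innerNr opprK. Qed.

Lemma dense_approx (D : set H) x (e : R) : dense D -> 0 < e ->
  exists2 g, D g & normsq (g - x) < e.
Proof.
move=> dD e0.
have s0 : 0 < (Num.sqrt e)%:C%C by rewrite ltcR sqrtr_gt0.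
have [||g [gx Dg]] := dD (ball x (Num.sqrt e)%:C%C).
- by exists x; exact: ballxx.
- exact: ball_open.
- exists g => //; move: gx.
  by rewrite -ball_normE /= distrC norm_lt ?sqrtr_gt0 // sqr_sqrtr // ltW.
Qed.

(** A point g of D is orthogonal to x, so |g - x|^2 = |g|^2 + |x|^2 >= |x|^2, and D could not
    approach a nonzero x. *)
Lemma dense_inner_eq0 (D : set H) x :
  dense D -> (forall g, D g -> '[x, g] = 0) -> x = 0.
Proof.
move=> dD xD; apply: normsq_eq0; apply/eqP; rewrite eq_le normsq_ge0 andbT.
rewrite leNgt; apply/negP => x0.
have [g Dg] := dense_approx x dD x0.
rewrite normsqD normsqN innerNr RecN Re_innerC (xD _ Dg) /=.
rewrite oppr0 mulr0 addr0; have := normsq_ge0 g; lra.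
Qed.

(* The vector [h] is obtained as limit of a minimising filter of the quadratic
   functional [|g|^2 - 2 Re (phi g)], which is Cauchy by the parallelogram
   identity. *)
Lemma riesz (D : set H) (phi : H -> R[i]) (M : R) : linear_subspace D ->
  (forall a x y, D x -> D y -> phi (a *: x + y) = a * phi x + phi y) ->
  (forall g, D g -> M <= normsq g - 2 * complex.Re (phi g)) ->
  exists h, (forall e, 0 < e -> exists2 g, D g & normsq (g - h) < e) /\
            (forall g, D g -> '[h, g] = phi g).
Proof.
move=> sD lphi JM.
pose J g := normsq g - 2 * complex.Re (phi g).
have [D0 DP] := sD.
have phiD x y : D x -> D y -> phi (x + y) = phi x + phi y.
  by move=> Dx Dy; rewrite -[x]scale1r lphi // scale1r mul1r.
have phi0 : phi 0 = 0.
  by apply: (addrI (phi 0)); rewrite -phiD // !addr0.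
have phiZ a x : D x -> phi (a *: x) = a * phi x.
  by move=> Dx; rewrite -[_ *: _]addr0 lphi // phi0 addr0.
pose E := J @` D; pose m := inf E.
have hE : has_inf E.
  split; first by exists (J 0), 0.
  by exists M => _ [g Dg <-]; exact: JM.
have mle g : D g -> m <= J g.
  by move=> Dg; apply: ge_inf; [exact: hE.2|exists g].
pose F := filter_from [set e : R | 0 < e] (fun e => [set g | D g /\ J g < m + e]).
have FF : ProperFilter F.
  apply: filter_from_proper; last first.
    move=> e e0; have [_ [g Dg <-] Jg] := inf_adherent e0 hE.
    by exists g.
  apply: filter_from_filter; first by exists 1 => /=.
  move=> e1 e2 /= e10 e20; exists (Num.min e1 e2).
    by rewrite /= lt_min e10.
  move=> g [Dg Jg]; split; split=> //; apply: (lt_le_trans Jg); rewrite lerD2l.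
    by rewrite ge_min lexx.
  by rewrite ge_min lexx orbT.
(* With z the midpoint, |x - y|^2 = 2 J x + 2 J y - 4 J z, and J z >= m. *)
have par x y e : D x -> D y -> J x < m + e -> J y < m + e ->
    normsq (x - y) < 4 * e.
  move=> Dx Dy Jx Jy.
  have Dz : D (2^-1 *: (x + y)) by apply: linear_subspaceZ => //; exact: linear_subspaceD.
  have := mle _ Dz; move: Jx Jy; rewrite /J phiZ ?phiD //; last exact: linear_subspaceD.
  have -> : (2^-1 : R[i]) = (2^-1 : R)%:C%C by rewrite fmorphV rmorph_nat.
  rewrite normsqZ RecM /= RecD !normsqD normsqN innerNr RecN.
  lra.
have cF : cauchy F.
  apply: cauchy_exP => eps eps0.
  have e0 : 0 < complex.Re eps by move: eps0; rewrite ltcE => /andP[].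
  have epsE : eps = (complex.Re eps)%:C%C by rewrite RRe_real // gtr0_real.
  pose e := complex.Re eps ^+ 2 / 4.
  have e'0 : 0 < e by rewrite divr_gt0 // exprn_gt0.
  have [_ [x Dx <-] Jx] := inf_adherent e'0 hE.
  exists x; exists e => // y [Dy Jy].
  rewrite -ball_normE /= epsE norm_lt //.
  have := par _ _ _ Dx Dy Jx Jy; rewrite /e; lra.
have Fh : F --> lim F := cauchy_cvg F cF.
set h := lim F in Fh.
(* The limit [h] may lie outside [D], where [J] has no known minimality, so variations are made at
   near minimisers [g] in [D] close to [h]. *)
have near_h e : 0 < e -> exists2 g, D g /\ J g < m + e & normsq (g - h) < e.
  move=> e0.
  have s0 : 0 < (Num.sqrt e)%:C%C by rewrite ltcR sqrtr_gt0.
  have Fb : F (ball h (Num.sqrt e)%:C%C) by apply: Fh; exact: nbhsx_ballx.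
  have Fe : F [set g | D g /\ J g < m + e] by exists e.
  have [g [gh ge]] := filter_ex (filterI Fb Fe).
  exists g => //; move: gh.
  by rewrite -ball_normE /= distrC norm_lt ?sqrtr_gt0 // sqr_sqrtr // ltW.
exists h; split=> [e e0|g0 Dg0].
  by have [g [Dg _] gh] := near_h _ e0; exists g.
apply/eqP; rewrite -subr_eq0; apply/eqP; set d := _ - _.
(* This is the first variation at [h]: compare J (g + t g0) >= m with J g < m + e, and replace <g, t
   g0> by <h, t g0> up to a small error. *)
have ineq t : 0 <= normsq (t *: g0) + 2 * complex.Re (t * d).
  rewrite leNgt; apply/negP; set q := (X in X < 0) => q0.
  pose b := normsq (t *: g0).
  (* 2 |Re <g - h, t g0>| <= |g - h|^2 / s + s |t g0|^2 *)
  pose s := - q / (2 * (b + 1)).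
  have b0 : 0 <= b := normsq_ge0 _.
  have s0 : 0 < s by rewrite /s divr_gt0 ?oppr_gt0 //; lra.
  have q4 : 0 < - q / 4 by lra.
  (* The margin -q is spent as -q/4 on the excess of J g over m, and as -q/4 and -q/2 on the two
     terms bounding the error 2 Re <g - h, t g0>. *)
  pose e := Num.min (- q / 4) (s * (- q / 4)).
  have e0 : 0 < e by rewrite lt_min q4 mulr_gt0.
  have [g [Dg Jg] gh] := near_h _ e0.
  have Dt : D (t *: g0) by exact: linear_subspaceZ.
  have := mle _ (linear_subspaceD sD Dg Dt).
  move: Jg; rewrite /J phiD // phiZ // normsqD RecD => Jg mJ.
  have e1 : e <= - q / 4 by rewrite ge_min lexx.
  have e2 : e <= s * (- q / 4) by rewrite ge_min lexx orbT.
  have sb : s * b <= - q / 2.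
    rewrite /s mulrAC ler_pdivrMr; last lra.
    have -> : - q / 2 * (2 * (b + 1)) = - q * b + - q by field.
    lra.
  have split_inner : complex.Re '[g, t *: g0] =
      complex.Re '[g - h, t *: g0] + complex.Re '[h, t *: g0].
    by rewrite innerDl RecD innerNl RecN; ring.
  have := normsq_ge0 ((g - h) - s%:C%C *: (t *: g0)).
  rewrite normsqD normsqN innerNr innerZr RecN normsqZ RecM /= -/b => am.
  have qE : q = b + 2 * (complex.Re '[h, t *: g0] - complex.Re (t * phi g0)).
    by rewrite /q /d mulrBr RecD RecN innerZr.
  set X := complex.Re '[g - h, t *: g0] in split_inner am.
  have : 2 * s * X <= s * (- q / 4) + s * (s * b).
    move: am gh e2; rewrite expr0n /= ; lra.
  rewrite -mulrDr -mulrA [2 * _]mulrC -mulrA ler_pM2l //.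
  lra.
(* For t = - s d^* with s = 1 / (1 + |g0|^2), the inequality reads 0 <= s |d|^2 (s |g0|^2 - 2);
   since s |g0|^2 <= 1, this forces d = 0. *)
have := ineq (- ((1 + normsq g0)^-1)%:C%C * d^*).
have n0 := normsq_ge0 g0.
set s := (1 + _)^-1.
have s1 : s * (1 + normsq g0) = 1 by rewrite mulVf // lt0r_neq0 //; lra.
have s0 : 0 < s by rewrite invr_gt0; lra.
rewrite normsqZ !(RecM, ImcM, Rec_conj, Imc_conj, RecN) /=.
case: (d) => dr di /=.
rewrite oppr0 => h1.
have h2 : 0 <= s * ((dr ^+ 2 + di ^+ 2) * (s * normsq g0 - 2)).
  by apply: (le_trans h1); rewrite le_eqVlt; apply/orP; left; apply/eqP; ring.
rewrite pmulr_rge0 // in h2.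
have : s * normsq g0 <= 1 by rewrite -s1 mulrDr; lra.
have := sqr_ge0 dr; have := sqr_ge0 di => i0 r0 sn.
have dd : dr ^+ 2 + di ^+ 2 = 0.
  apply/eqP; rewrite eq_le addr_ge0 // andbT leNgt; apply/negP => p0.
  move: h2; rewrite pmulr_rge0 //; lra.
have /eqP : dr ^+ 2 = 0 by lra.
have /eqP : di ^+ 2 = 0 by lra.
by rewrite !sqrf_eq0 => /eqP -> /eqP ->.
Qed.

End inner_product.

(** * Adjoints, symmetric parts and nonnegative operators *)

Section operators.
Context (R : realType) (H : hilbertType R).
Implicit Types (T : operator H) (V Vhalf : {linear H -> H}).

Lemma adjointP T f g : dom (adjoint T) f -> dom T g ->
  '[f, T g] = '[adjoint T f, g].
Proof. by move=> [h Th] Tg; rewrite /= (xgetPex 0 (ex_intro _ _ Th)). Qed.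

Lemma adjoint_unique T f h : dense (dom T) -> adjoint_graph T f h ->
  dom (adjoint T) f /\ adjoint T f = h.
Proof.
move=> dT fh; have fT : dom (adjoint T) f by exists h.
split=> //; apply/eqP; rewrite -subr_eq0; apply/eqP.
apply: (dense_inner_eq0 dT) => g Tg.
by rewrite innerDl innerNl -adjointP // fh // subrr.
Qed.

(** By density T f is the only candidate for the adjoint at f, so membership can be tested on the
    form alone. *)
Lemma HsymP T f : dense (dom T) ->
  Hsym T f <-> dom T f /\ forall g, dom T g -> '[f, T g] = '[T f, g].
Proof.
move=> dT; split=> [[Tf aTf fE]|[Tf fT]].
  by split=> // g Tg; rewrite fE adjointP.
by have [aTf fE] := adjoint_unique dT fT; split.
Qed.

Lemma Hsym_subspace T : densely_defined T -> linear_subspace (Hsym T).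
Proof.
move=> [[sT lT] dT]; split.
  apply/HsymP => //; split; first by case: sT.
  by move=> g Tg; rewrite (linear_on0 sT lT) !inner0l.
move=> a x y /(HsymP _ dT) [Tx xP] /(HsymP _ dT) [Ty yP].
apply/HsymP => //; split; first by case: sT => _; apply.
by move=> g Tg; rewrite lT // !innerDl !innerZl xP // yP.
Qed.

Lemma dense_subset (D D' : set H) : D `<=` D' -> dense D -> dense D'.
Proof.
by move=> DD' dD O O0 oO; have [x [Ox Dx]] := dD O O0 oO; exists x; split; auto.
Qed.

(** Polarisation: <z, V z> is real, hence equal to <V z, z>; taking z = x + y and z = x + i y
    compares the sums and the differences of the cross terms. *)
Lemma nonneg_symmetric V x y : nonneg_operator V -> '[x, V y] = '[V x, y].
Proof.
move=> V0.
have D z : '[z, V z] = '[V z, z].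
  by rewrite -[RHS]inner_conj; apply/esym/CrealP/ger0_real/V0.
have := D (x + y); have := D (x + 'i *: y).
rewrite !linearD !linearZ /= !(innerDl, innerDr, innerZl, innerZr) conjCi.
rewrite (D x) (D y) => h1 h2.
have i0 : ('i : R[i]) != 0 := neq0Ci _.
have e1 : '[x, V y] - '[y, V x] = '[V x, y] - '[V y, x].
  apply: (mulfI i0); apply/eqP; rewrite -subr_eq0; apply/eqP.
  move: h1 => /eqP; rewrite -subr_eq0 => /eqP <-; ring.
have e2 : '[x, V y] + '[y, V x] = '[V x, y] + '[V y, x].
  apply/eqP; rewrite -subr_eq0; apply/eqP.
  move: h2 => /eqP; rewrite -subr_eq0 => /eqP <-; ring.
have : 2 * '[x, V y] = 2 * '[V x, y].
  have -> : 2 * '[x, V y] = ('[x, V y] - '[y, V x]) + ('[x, V y] + '[y, V x]) by ring.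
  by rewrite e1 e2; ring.
by apply: mulfI; rewrite pnatr_eq0.
Qed.

Lemma bounded_normsq V : bounded_operator V ->
  exists2 K : R, 0 <= K & forall x, normsq (V x) <= K * normsq x.
Proof.
(* The bound [M] is an element of [R[i]] that need not be real if [H] is trivial; its squared
   modulus is a real constant in all cases. *)
move=> [M VM]; exists (complex.Re M ^+ 2 + complex.Im M ^+ 2).
  by rewrite addr_ge0 // sqr_ge0.
move=> x; rewrite -lecR rmorphM /= add_Re2_Im2 -!normsq_norm -exprMn.
rewrite ler_pXn2r // ?nnegrE ?mulr_ge0 //.
apply: (le_trans (VM x)); have Mx : 0 <= M * `|x| by apply: le_trans (VM x).
by rewrite -(ger0_norm Mx) normrM normr_id.
Qed.

(** * The square root of [V] and domains of dissipative extensions *)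

Section sqrt.
Context (V Vhalf : {linear H -> H}) (sV : is_sqrt V Vhalf).

Lemma sqrt_symmetric x y : '[x, Vhalf y] = '[Vhalf x, y].
Proof. by case: sV => _ + _; exact: nonneg_symmetric. Qed.

Lemma sqrt_inner x y : '[x, V y] = '[Vhalf x, Vhalf y].
Proof. by rewrite -sqrt_symmetric; case: sV => _ _ ->. Qed.

Lemma kerV_sqrt x : kerV V x <-> Vhalf x = 0.
Proof.
split=> [Vx|Vx]; last by case: sV => _ _ VE; rewrite /kerV /= -VE Vx linear0.
by apply: normsq_eq0; rewrite /normsq -sqrt_inner Vx inner0r.
Qed.

(** If k = V^(1/2) x and p is the projection of x onto ker V, then x - p is orthogonal to ker V and
    has the same image k. *)
Lemma inv_sqrtP k : range Vhalf k ->
  orthogonal_complement (kerV V) (inv_sqrt V Vhalf k) /\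
  Vhalf (inv_sqrt V Vhalf k) = k.
Proof.
move=> [x _ <-].
suff : exists x', orthogonal_complement (kerV V) x' /\ Vhalf x' = Vhalf x.
  by move=> ex; exact: (xgetPex 0 ex).
have sK : linear_subspace (kerV V).
  split; first exact: linear0.
  by move=> a y z; rewrite /kerV /= => Vy Vz; rewrite linearP Vy Vz scaler0 addr0.
have [||p [pK pE]] := @riesz _ _ _ (fun g => '[x, g]) (- normsq x) sK.
- by move=> a y z _ _; rewrite innerDr innerZr.
- move=> g _; have := normsq_ge0 (g - x).
  by rewrite normsqD normsqN innerNr RecN Re_innerC; lra.
(* [riesz] places [p] only in the closure of ker V; boundedness of [Vhalf] carries the kernel
   property over to it. *)
have Vp : Vhalf p = 0.
  have [bV _ _] := sV; have [K K0 VK] := bounded_normsq bV.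
  apply: normsq_eq0; apply/eqP; rewrite eq_le normsq_ge0 andbT.
  apply/ler_addgt0Pr => e e0; rewrite add0r.
  have [|g /kerV_sqrt Vg gp] := pK (e / (K + 1)).
    by rewrite divr_gt0 //; lra.
  have -> : Vhalf p = - Vhalf (g - p) by rewrite linearB /= Vg sub0r opprK.
  rewrite normsqN; apply: (le_trans (VK _)).
  rewrite -(@ler_pM2r _ (K + 1)^-1) ?invr_gt0; last lra.
  apply: le_trans (ltW gp); rewrite ler_pdivrMr; last lra.
  by rewrite mulrC ler_wpM2l ?normsq_ge0 //; lra.
exists (x - p); split; last by rewrite linearB /= Vp subr0.
by move=> g Kg; rewrite -inner_conj innerDl innerNl pE // subrr rmorph0.
Qed.

(* Nonnegativity of [Im <u, T u>] at [u = f - i s g] bounds [Re <f, S g>] in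
   terms of [g], so that [riesz] applies to [g |-> <f, S g>]. *)
Lemma dom_dissipative_extension (S : operator H) T :
  symmetric_operator S -> extends (add_iV S V) T -> dissipative T ->
  dom T `<=` dom (adjoint S).
Proof.
move=> [[[sS lS] dS] symS] [ST TS] [[[sT lT] dT] disT] f Tf.
have [bV _ _] := sV; have [K K0 VK] := bounded_normsq bV.
(* This choice makes s |V^(1/2) g|^2 at most |g|^2 / 4, also when [K] is 0. *)
pose s : R := (4 * (K + 1))^-1.
have s0 : 0 < s by rewrite invr_gt0; lra.
(* Besides <f, S g>, the terms of first order in g combine to Re <w, g>. *)
pose w := T f + 'i *: V f.
pose a := complex.Im '[f, T f].
have [||h [_ hE]] := @riesz _ _ _ (fun g => '[f, S g])
    (- (2 * normsq w + 2 * (a / s))) sS.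
- by move=> b x y Sx Sy; rewrite lS // innerDr innerZr.
- move=> g Sg; have Tg := ST g Sg.
  have := disT (f - ('i * s%:C%C) *: g)
    (linear_subspaceB sT Tf (linear_subspaceZ sT _ Tg)).
  rewrite (linear_onB lT) // ?(linear_onZ sT lT) //; last exact: linear_subspaceZ.
  have -> : T g = S g + 'i *: V g by exact: TS.
  rewrite -complexIm ler0c -complexiE.
  rewrite !(innerDl, innerNl, innerDr, innerNr, innerZl, innerZr).
  have symSg : complex.Im '[g, S g] = 0.
    by have := Imc_conj '[g, S g]; rewrite inner_conj -symS //; lra.
  rewrite [ '[g, V g] ]sqrt_inner inner_normsq.
  rewrite !(ImcD, ImcN, RecD, RecN, ImcM, RecM, Rec_conj, Imc_conj) /=.
  rewrite symSg -/a => ineq.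
  have wg : complex.Re '[w, g] = complex.Re '[g, T f] + complex.Im '[f, V g].
    rewrite innerDl innerZl RecD -complexiE RecM /= (Re_innerC (T f)).
    by rewrite sqrt_inner sqrt_symmetric; case: sV => _ _ ->; ring.
  (* This is Re <w, g> <= |g|^2 / 4 + |w|^2. With the quarter from [V] it yields Re <f, S g> <=
     |g|^2 / 2 + |w|^2 + a / s, the bound that [riesz] asks for. *)
  have := normsq_ge0 (g - 2%:R *: w).
  have -> : (2 : R[i]) = (2 : R)%:C%C by rewrite rmorph_nat.
  rewrite normsqD normsqN innerNr innerZr RecN normsqZ RecM /= (Re_innerC g) wg => nw.
  have sa : s * (a / s) = a by rewrite mulrCA divff ?mulr1 // gt_eqF.
  have sK : s * (4 * (K + 1)) = 1 by rewrite mulVf // gt_eqF //; lra.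
  have n0 := normsq_ge0 g.
  have sn : s * normsq (Vhalf g) <= normsq g / 4.
    apply: (@le_trans _ _ (s * ((K + 1) * normsq g))).
      by rewrite ler_pM2l //; have := VK g; lra.
    have -> : s * ((K + 1) * normsq g) = (s * (4 * (K + 1))) * normsq g / 4 by field.
    by rewrite sK mul1r.
  have : s * complex.Re '[f, S g] <= s * (a / s + complex.Re '[g, T f]
      + complex.Im '[f, V g] + s * normsq (Vhalf g)).
    rewrite !mulrDr sa -subr_ge0; apply: (le_trans ineq).
    by rewrite le_eqVlt; apply/orP; left; apply/eqP; ring.
  rewrite ler_pM2l //; move: nw sn; lra.
by exists h => g Sg; rewrite hE.
Qed.

End sqrt.
End operators.

(** * Matrices and the boundary condition *)

Section matrices.
Context (R : realType) (n : nat).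
Implicit Types (u v : 'cV[R[i]]_n) (M : 'M[R[i]]_n).

Lemma innerCE u v : innerC u v = (u^t* *m v) 0 0.
Proof. by rewrite mxE; apply: eq_bigr => i _; rewrite !mxE. Qed.

Lemma innerC_adj M u v : innerC (M *m u) v = innerC u (M^t* *m v).
Proof. by rewrite !innerCE trmx_mul map_mxM mulmxA. Qed.

Lemma innerCDr u v w : innerC u (v + w) = innerC u v + innerC u w.
Proof. by rewrite !innerCE mulmxDr mxE. Qed.

Lemma innerCZr a u v : innerC u (a *: v) = a * innerC u v.
Proof. by rewrite !innerCE -scalemxAr mxE. Qed.

Lemma innerCNr u v : innerC u (- v) = - innerC u v.
Proof. by rewrite -scaleN1r innerCZr mulN1r. Qed.

Lemma innerC_eq0 u : (forall v, innerC u v = 0) -> u = 0.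
Proof.
move=> u0; apply/colP => i; rewrite mxE; apply/eqP; rewrite -conjC_eq0; apply/eqP.
have := u0 (delta_mx i 0); rewrite /innerC (bigD1 i) //= big1 ?addr0.
  by rewrite mxE !eqxx mulr1.
by move=> j ji; rewrite mxE (negbTE ji) mulr0.
Qed.

Lemma mxrank_adj M : \rank (M^t*) = \rank M.
Proof. by rewrite mxrank_map mxrank_tr. Qed.

(* With [X = C^* (B^* )^-1] the boundary condition reads [G0 f = X^* (G1 f)]. *)
Lemma boundary_form (B C : 'M[R[i]]_n) u0 u1 v0 v1 : B \in unitmx ->
  B *m u0 = C *m u1 -> B *m v0 = C *m v1 ->
  innerC u0 v1 - innerC u1 v0 =
  2 * 'i * innerC u1 (mxIm (C^t* *m invmx (B^t*)) *m v1).
Proof.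
move=> uB; set X := C^t* *m _.
have XE : X^t* = invmx B *m C.
  by rewrite /X trmx_mul map_mxM /= trmxCK trmx_inv map_invmx trmxCK.
have E x y : B *m x = C *m y -> x = X^t* *m y.
  by move=> xy; rewrite XE -mulmxA -xy mulKmx.
move=> /E -> /E ->; rewrite innerC_adj trmxCK /mxIm -scalemxAl innerCZr mulrA.
rewrite mulfV ?mul1r ?mulf_neq0 ?neq0Ci ?pnatr_eq0 //.
by rewrite mulmxBl innerCDr innerCNr.
Qed.

(** [MK] is a Gram matrix; this identifies its form with the term left over when the square is
    completed. *)
Lemma innerC_MK (H : hilbertType R) (V Vhalf : {linear H -> H})
    (k : 'I_n -> H) u v :
  innerC u (MK V Vhalf k *m v) =
  '[\sum_i u i 0 *: inv_sqrt V Vhalf (k i),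
    \sum_i v i 0 *: inv_sqrt V Vhalf (k i)].
Proof.
rewrite inner_suml; apply: eq_bigr => r _; congr (_ * _).
by rewrite mxE inner_sumr; apply: eq_bigr => s _; rewrite mxE mulrC.
Qed.

End matrices.

(** * Completing the square *)

Section dissipation_form.
Context (R : realType) (H : hilbertType R) (V Vhalf : {linear H -> H}).
Hypothesis sV : is_sqrt V Vhalf.
Context (l : nat) (k : 'I_l -> H) (rk : forall j, range Vhalf (k j)).
Implicit Types (f g : H) (c d : 'cV[R[i]]_l).

Definition invsqrt_comb c : H := \sum_i c i 0 *: inv_sqrt V Vhalf (k i).

Lemma sqrt_comb c : Vhalf (invsqrt_comb c) = \sum_j c j 0 *: k j.
Proof.
rewrite linear_sum; apply: eq_bigr => i _.
by rewrite linearZ /= (inv_sqrtP sV (rk i)).2.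
Qed.

Lemma comb_orthogonal c : orthogonal_complement (kerV V) (invsqrt_comb c).
Proof.
move=> y Vy; rewrite inner_sumr big1 // => i _.
by rewrite (inv_sqrtP sV (rk i)).1 // mulr0.
Qed.

(** For c = [Gamma1 f] this is the vector w f; keeping c separate frees the algebra from the
    boundary maps. *)
Definition defect f c : H := Vhalf f - ('i / 2) *: invsqrt_comb c.

(* Completing the square in the imaginary part of [<f, (S^* + iV) f + k_c>]. *)
Lemma complete_square f g Sf Sg c d :
  '[f, Sg + 'i *: V g + \sum_j d j 0 *: k j] -
  '[Sf + 'i *: V f + \sum_j c j 0 *: k j, g] =
  '[f, Sg] - '[Sf, g] + 2 * 'i *
    ('[defect f c, defect g d] - 4^-1 * '[invsqrt_comb c, invsqrt_comb d]).
Proof.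
have Vsym : '[V f, g] = '[Vhalf f, Vhalf g].
  by rewrite -inner_conj (sqrt_inner sV) inner_conj.
rewrite /defect -!sqrt_comb.
rewrite !(innerDl, innerDr, innerZl, innerZr, innerNl, innerNr).
rewrite (sqrt_inner sV) !(sqrt_symmetric sV) Vsym -(sqrt_symmetric sV _ g).
rewrite rmorphM /= fmorphV /= conjCi rmorph_nat.
have ii : ('i : R[i]) * 'i = -1 by rewrite -expr2 sqrCi.
by field: ii.
Qed.

Lemma comb0 : invsqrt_comb 0 = 0.
Proof. by apply: big1 => i _; rewrite mxE scale0r. Qed.

Lemma defect0 f : defect f 0 = Vhalf f.
Proof. by rewrite /defect comb0 scaler0 subr0. Qed.

(** Both V^(1/2) f and the combination of the V^(-1/2) k_j are orthogonal to ker V, so a defect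
    vector that lies in this kernel is orthogonal to itself. *)
Lemma defect_eq0 f c : Vhalf (defect f c) = 0 -> defect f c = 0.
Proof.
move=> Vd; apply: normsq_eq0.
rewrite /normsq {2}/defect innerDr innerNr innerZr (sqrt_symmetric sV) Vd inner0l.
by rewrite comb_orthogonal ?mulr0 ?subr0 //; apply/(kerV_sqrt sV).
Qed.

End dissipation_form.

(** * The symmetric part of [Ahat] *)

Theorem lemma4p14 (R : realType) (H : hilbertType R)
    (S : operator H) (V Vhalf : {linear H -> H}) (Ahat : operator H)
    (l : nat) (Gamma0 Gamma1 : H -> 'cV[R[i]]_l) (B C : 'M[R[i]]_l)
    (k : 'I_l -> H) :
  let Shat := restrict_op (adjoint S) (dom Ahat) in
  let Stilde := restrict_op (adjoint S) (Hsym Shat) in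
  let N := mxIm (C^t* *m invmx (B^t*)) - 4^-1 *: MK V Vhalf k in
  symmetric_operator S -> closed_operator S ->
  (exists n, has_defect_indices S n n) ->
  bounded_operator V -> nonneg_operator V -> is_sqrt V Vhalf ->
  extends (add_iV S V) Ahat -> maximally_dissipative Ahat ->
  has_defect_indices Stilde l l ->
  boundary_triple Stilde Gamma0 Gamma1 ->
  B \in unitmx -> C \in unitmx ->
  dom Shat =
    [set f | dom (adjoint Stilde) f /\ B *m Gamma0 f = C *m Gamma1 f] ->
  (forall j, range Vhalf (k j)) ->
  (forall f, dom Ahat f ->
     Ahat f = adjoint S f + 'i *: V f + \sum_j Gamma1 f j 0 *: k j) ->
  exists W : set H,
    [/\ linear_subspace W /\ W `<=` Hsym Ahat,
        W `&` dom Stilde = [set 0] /\ W `&` kerV V = [set 0],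
        exists2 m, (m <= l - \rank N)%N & has_dim m W,
        direct_sum (Hsym Ahat) (dom Stilde `&` kerV V) W
      & posdef N -> W = [set 0]].
Proof.
move=> Shat Stilde N symS _ _ _ _ sV extA [disA _] _ bt uB _ domShat rk AE.
have [[lS dS] symSP] := symS; have [SA AS] := extA.
have [[[sA lA] dA] _] := disA.
have AS' : dom Ahat `<=` dom (adjoint S) :=
  dom_dissipative_extension sV symS extA disA.
have domShatE : dom Shat = dom Ahat.
  by apply/seteqP; split=> [f []|f Af] //; split=> //; exact: AS'.
have SadjS f : dom S f -> dom (adjoint S) f /\ adjoint S f = S f.
  by move=> Sf; apply: adjoint_unique => // g Sg; exact: symSP.
have dShat : dense (dom Shat) by rewrite domShatE.
have domStildeE : dom Stilde = Hsym Shat.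
  apply/seteqP; split=> [f []|f Hf] //; split=> //.
  by case: Hf => -[_ aSf].
have StildeP f : dom Stilde f <-> dom Ahat f /\
    forall g, dom Ahat g -> '[f, adjoint S g] = '[adjoint S f, g].
  by rewrite domStildeE (HsymP _ dShat) domShatE.
have SSt : dom S `<=` dom Stilde.
  move=> f Sf; apply/StildeP; split; first exact: SA.
  move=> g Ag; have [_ ->] := SadjS _ Sf.
  by rewrite -[RHS]inner_conj (adjointP (AS' _ Ag) Sf) inner_conj.
have dSt : dense (dom Stilde) := dense_subset SSt dS.
(* The boundary triple identity concerns the adjoint of [Stilde]; on dom Ahat it may thus be read
   for the adjoint of [S], which occurs in [AE]. *)
have StE f : dom Ahat f -> dom (adjoint Stilde) f /\ adjoint Stilde f = adjoint S f.
  move=> Af; apply: adjoint_unique => // g /StildeP [Ag gP].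
  by rewrite -[RHS]inner_conj gP // inner_conj.
have [[lG0 lG1] surG green domSt] := bt.
have domA f : dom Ahat f <->
    dom (adjoint Stilde) f /\ B *m Gamma0 f = C *m Gamma1 f.
  by rewrite -domShatE domShat.
pose y c : H := invsqrt_comb V Vhalf k c.
have formA f g : dom Ahat f -> dom Ahat g ->
    '[f, Ahat g] - '[Ahat f, g] = 2 * 'i *
    ('[defect V Vhalf k f (Gamma1 f), defect V Vhalf k g (Gamma1 g)] +
     innerC (Gamma1 f) (N *m Gamma1 g)).
  move=> Af Ag; rewrite !AE // (complete_square sV rk).
  have [tf <-] := StE f Af; have [tg <-] := StE g Ag.
  rewrite green // (boundary_form uB ((domA f).1 Af).2 ((domA g).1 Ag).2).
  rewrite /N mulmxBl innerCDr innerCNr -(scalemxAl 4^-1) innerCZr innerC_MK; ring.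
have two_i : (2 * 'i : R[i]) != 0 by rewrite mulf_neq0 ?neq0Ci ?pnatr_eq0.
have StG f : dom Stilde f -> [/\ dom Ahat f, Gamma0 f = 0 & Gamma1 f = 0].
  by move=> Sf; move: (Sf); rewrite domSt => -[_ -> ->]; case/StildeP: Sf.
have HsymA f : Hsym Ahat f <-> [/\ dom Ahat f,
    defect V Vhalf k f (Gamma1 f) = 0 & forall c, innerC (Gamma1 f) (N *m c) = 0].
  split=> [/(HsymP _ dA) [Af fP]|[Af df fN]]; last first.
    apply/(HsymP _ dA); split=> // g Ag; apply/eqP; rewrite -subr_eq0 formA //.
    by rewrite df inner0l fN addr0 mulr0.
  have form0 g : dom Ahat g -> '[defect V Vhalf k f (Gamma1 f),
      defect V Vhalf k g (Gamma1 g)] + innerC (Gamma1 f) (N *m Gamma1 g) = 0.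
    move=> Ag; apply: (mulfI two_i); rewrite -formA // fP // subrr mulr0 //.
  (* For g in dom Stilde the form is <w f, V^(1/2) g>, so density gives V^(1/2) (w f) = 0, and
     [defect_eq0] removes the root. *)
  have df : defect V Vhalf k f (Gamma1 f) = 0.
    apply: (defect_eq0 sV rk); apply: (dense_inner_eq0 dSt) => g Sg.
    have [Ag _ g0] := StG g Sg; have := form0 g Ag.
    rewrite g0 defect0 (sqrt_symmetric sV) mulmx0 => <-.
    by rewrite -[X in _ + innerC _ X](scale0r 0) innerCZr mul0r addr0.
  split=> // c.
  (* The value of [Gamma0] is chosen to satisfy the boundary condition, so [Gamma1] is onto already
     from dom Ahat. *)
  have [g [tg g0 g1]] := surG (invmx B *m C *m c) c.
  have Ag : dom Ahat g.
    by apply/domA; split=> //; rewrite g0 g1 -mulmxA mulKVmx.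
  by have := form0 g Ag; rewrite df inner0l add0r g1.
(* Since [B] is invertible, the boundary condition turns Gamma1 f = 0 into Gamma0 f = 0, that is, f
   in dom Stilde; and w f reduces to V^(1/2) f. *)
have kerG1 f : Hsym Ahat f /\ Gamma1 f = 0 <-> (dom Stilde `&` kerV V) f.
  split=> [[/HsymA [Af df _] f1]|[Sf Vf]].
    split; last by apply/(kerV_sqrt sV); move: df; rewrite f1 defect0.
    have [tf f01] := (domA f).1 Af.
    by rewrite domSt; split=> //; rewrite -[LHS](mulKmx uB) f01 f1 !mulmx0.
  have [Af _ f1] := StG f Sf; split=> //; apply/HsymA; split=> //.
    by rewrite f1 defect0; apply/(kerV_sqrt sV).
  move=> c; rewrite f1 innerCE trmx0 map_mx0 mul0mx mxE //.
(* If V f = 0 and w f = 0, the combination of the V^(-1/2) k_j vanishes too, and the forms of [Ahat]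
   and of the adjoint of [S] agree at f. This reduces the intersection of [W] with ker V to that
   with dom Stilde. *)
have kerW f : Hsym Ahat f -> kerV V f -> dom Stilde f.
  move=> Hf /(kerV_sqrt sV) Vf.
  have [/(HsymP _ dA) [Af fP] /HsymA [_ df _]] := conj Hf Hf.
  have yf : y (Gamma1 f) = 0.
    move: df; rewrite /defect Vf sub0r => /eqP; rewrite oppr_eq0 scaler_eq0.
    by rewrite mulf_eq0 invr_eq0 pnatr_eq0 orbF (negbTE (neq0Ci _)) => /eqP.
  apply/StildeP; split=> // g Ag; apply/eqP; rewrite -subr_eq0; apply/eqP.
  have /eqP := fP g Ag; rewrite -subr_eq0 !AE // (complete_square sV rk) df.
  by rewrite -/(y _) yf !inner0l mulr0 subr0 mulr0 addr0 => /eqP.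
have sH := Hsym_subspace disA.1.
have lH : linear_on (Hsym Ahat) Gamma1.
  move=> a x z /HsymA [Ax _ _] /HsymA [Az _ _].
  by apply: lG1; [case/domA: Ax|case/domA: Az].
(* The row condition on Gamma1 x is rewritten as a column equation, as [exists_kernel_complement]
   expects; [N] and its adjoint have the same rank. *)
have NG x : Hsym Ahat x -> N^t* *m Gamma1 x = 0.
  move=> /HsymA [_ _ xN]; apply: innerC_eq0 => v.
  by rewrite innerC_adj trmxCK xN.
have [m [b [ml Hb freeb genb]]] := exists_kernel_complement sH lH NG.
rewrite mxrank_adj in ml.
pose W := [set x | exists c : 'I_m -> R[i], x = \sum_i c i *: b i].
have WH : W `<=` Hsym Ahat by move=> _ [c ->]; exact: linear_subspace_sum.
have W0 : W 0 by exists (fun=> 0); rewrite big1 // => i _; rewrite scale0r.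
have WG x : W x -> Gamma1 x = 0 -> x = 0.
  by move=> [c ->] /freeb c0; rewrite big1 // => i _; rewrite c0 scale0r.
have WS : W `&` dom Stilde = [set 0].
  apply/seteqP; split=> [x [Wx /StG [_ _ x1]]|_ ->]; first exact: WG.
  split=> //; suff /kerG1[] : Hsym Ahat 0 /\ Gamma1 0 = 0 by [].
  by split; [exact: WH|exact: (linear_on0 sH lH)].
have WK : W `&` kerV V = [set 0].
  apply/seteqP; split=> [x [Wx Kx]|_ ->]; last by split=> //; exact: linear0.
  by rewrite -WS; split=> //; apply: kerW => //; exact: WH.
exists W; split=> //.
- split=> //; split=> // a _ _ [c ->] [d ->]; exists (fun i => a * c i + d i).
  rewrite scaler_sumr -big_split; apply: eq_bigr => i _.
  by rewrite scalerDl scalerA.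
- exists m => //; exists b; split=> // c c0; apply: freeb.
  by rewrite c0 (linear_on0 sH lH).
- split; apply/seteqP; split.
  + move=> x Hx; have [c c0] := genb x Hx.
    exists (x - \sum_i c i *: b i), (\sum_i c i *: b i); split; last by rewrite subrK.
      apply/kerG1; split=> //; apply: (linear_subspaceB sH Hx).
      exact: linear_subspace_sum.
    by exists c.
  + move=> _ [u [v [/kerG1 [Hu _] Wv ->]]].
    by apply: (linear_subspaceD sH) => //; exact: WH.
  + by move=> x [[Sx _] Wx]; rewrite -WS.
  + move=> _ ->; split=> //; apply/kerG1; split; first exact: WH.
    exact: (linear_on0 sH lH).
(* A nonzero Gamma1 x would make <G1 x, N (G1 x)> positive, whereas it is 0 on [Hsym Ahat]. *)
- move=> posN; apply/seteqP; split=> [x Wx|_ ->] //=.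
  apply: WG => //; apply/eqP; apply: contraT => /posN.
  by have /HsymA [_ _ ->] := WH _ Wx; rewrite ltxx.
Qed.
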